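(* Let $A\in\mathbb{R}^{n\times n}$ and $C\in\mathbb{R}^{m\times n}$. The union $\bigcup_{t\ge 0}\operatorname{Im}\,(Ce^{At})^{\top}$ is not contained in a proper algebraic variety of $\mathbb{R}^n$ if and only if the tensor systems $$\dot x^{[p]}(t) = A_{[p]}x^{[p]}(t),\qquad y^{[p]}(t) = C^{[p]}x^{[p]}(t)$$ are observable for all integers $p\ge 1$. Moreover, under these equivalent conditions, the system $(A,C)$ is ensemble observable for the class of moment-determinate initial distributions.
   Context: Algebraic varieties: an algebraic variety of $\mathbb{R}^n$ is the zero set in $\mathbb{R}^n$ of a real polynomial in $n$ variables; it is proper if it is not all of $\mathbb{R}^n$. Tensor systems: for $x\in\mathbb{R}^k$ and an integer $p\ge 1$, $x^{[p]}\in\mathbb{R}^{N(k,p)}$, with $N(k,p)=\binom{k+p-1}{p}$, denotes the vector of weighted monomials $w_p(\alpha)\,x^{\alpha}$, where $\alpha=(\alpha_1,\dots,\alpha_k)$ runs through all multi-indices of non-negative integers with $|\alpha|=p$, listed in decreasing lexicographic order, $x^\alpha = x_1^{\alpha_1}\cdots x_k^{\alpha_k}$, and $w_p(\alpha)=\sqrt{p!/(\alpha_1!\cdots\alpha_k!)}$. For $C\in\mathbb{R}^{m\times n}$, $C^{[p]}$ is the unique $N(m,p)\times N(n,p)$ matrix with $(Cx)^{[p]} = C^{[p]}x^{[p]}$ for all $x\in\mathbb{R}^n$. For $A\in\mathbb{R}^{n\times n}$, $A_{[p]}$ is the unique $N(n,p)\times N(n,p)$ matrix such that every solution of $\dot x(t)=Ax(t)$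 satisfies $\frac{d}{dt}x^{[p]}(t) = A_{[p]}x^{[p]}(t)$. The tensor system $(A_{[p]},C^{[p]})$ is viewed as a linear system with state space $\mathbb{R}^{N(n,p)}$. A linear system $(F,H)$ is observable if $\bigcap_{t\ge 0}\ker He^{Ft}=\{0\}$. Ensemble observability: the linear system $(A,C)$ is $\dot x(t) = Ax(t)$, $y(t) = Cx(t)$. For a probability distribution $\mathbb{P}_0$ of the initial state on $\mathbb{R}^n$, the output distribution at time $t\ge 0$, denoted $\mathbb{P}_{y(t)|\mathbb{P}_0}$, is the push-forward of $\mathbb{P}_0$ under $x\mapsto Ce^{At}x$. Given a class $\mathcal{K}$ of probability distributions on $\mathbb{R}^n$, $(A,C)$ is ensemble observable for the class $\mathcal{K}$ if for all continuous (i.e. admitting a density with respect to Lebesgue measure) $\mathbb{P}_0',\mathbb{P}_0''\in\mathcal{K}$: if $\mathbb{P}_{y(t)|\mathbb{P}_0'} = \mathbb{P}_{y(t)|\mathbb{P}_0''}$ for all $t\ge 0$, then $\mathbb{P}_0'=\mathbb{P}_0''$. Moment-determinacy: a probability distribution $\mathbb{P}$ on $\mathbb{R}^n$ has finite moments if $\int\|x\|^p\,d\mathbb{P}(x)<\infty$ for all $p\in\mathbb{N}$; its moments are $m_\alpha=\int x^\alpha\,d\mathbb{P}(x)$ for multi-indices $\alpha$. It is moment-determinate if it has finite moments and is uniquely determined by them, i.e. any probability distribution on $\mathbb{R}^n$ with finite moments and the same moments $m_\alpha$ for all $\alpha$ equals $\mathbb{P}$. *)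

(* Defs.v *)
From HB Require Import structures.
From mathcomp Require Import all_boot all_order all_algebra.
From mathcomp Require Import all_classical all_reals all_analysis.
From mathcomp Require mpoly.

Set Implicit Arguments.
Unset Strict Implicit.
Unset Printing Implicit Defensive.

Import Order.TTheory GRing.Theory Num.Theory.
Import numFieldNormedType.Exports.

Local Open Scope classical_set_scope.
Local Open Scope ring_scope.

Section Varieties.
Variables (R : realType) (n : nat).

Definition algebraic_variety (V : set 'cV[R]_n) : Prop :=
  exists f : mpoly.mpoly n R,
    V = [set x : 'cV[R]_n | mpoly.meval (fun i => x i 0) f = 0].

Definition proper_algebraic_variety (V : set 'cV[R]_n) : Prop :=
  algebraic_variety V /\ V <> setT.

Definition in_proper_algebraic_variety (S : set 'cV[R]_n) : Prop :=
  exists V : set 'cV[R]_n, proper_algebraic_variety V /\ S `<=` V.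

End Varieties.

Section LinearSystems.
Variable R : realType.

Definition expmx (k : nat) (F : 'M[R]_k) : 'M[R]_k :=
  limn (series (fun i => (i`!%:R)^-1 *: F ^+ i)).

Definition image_union (n m : nat) (A : 'M[R]_n) (C : 'M[R]_(m, n)) :
    set 'cV[R]_n :=
  \bigcup_(t in [set t : R | 0 <= t])
    range (fun v : 'cV[R]_m => (C *m expmx (t *: A))^T *m v).

Definition observable (k l : nat) (F : 'M[R]_k) (H : 'M[R]_(l, k)) : Prop :=
  \bigcap_(t in [set t : R | 0 <= t])
    [set x : 'cV[R]_k | H *m expmx (t *: F) *m x = 0] = [set 0].

Definition solution (k : nat) (F : 'M[R]_k) (x : R -> 'cV[R]_k) : Prop :=
  forall t : R, is_derive t 1 x (F *m x t).

End LinearSystems.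

Section MultiIndices.

(* The bound p on the entries of a multi-index of degree p is only there to
   make the enumeration finite. *)
Definition multi_indices (k p : nat) : seq (k.-tuple nat) :=
  sort (fun a b : k.-tuplelexi nat => (b <= a)%O)
    [seq map_tuple val a | a : k.-tuple 'I_p.+1 in
       [pred a : k.-tuple 'I_p.+1 | (\sum_(i < k) tnth a i)%N == p]].

Definition tdim (k p : nat) : nat := 'C(k + p - 1, p).

Lemma mem_multi_indices k p (a : k.-tuple nat) :
  (a \in multi_indices k p) = ((\sum_(i < k) tnth a i)%N == p).
Proof.
rewrite mem_sort; apply/fintype.imageP/eqP => [[b]|sa].
  rewrite inE => /eqP sb ->.
  by rewrite -[RHS]sb; apply: eq_bigr => i _; rewrite tnth_map.
have ap i : (tnth a i < p.+1)%N.
  by rewrite ltnS -sa (bigD1 i)//= leq_addr.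
exists [tuple Ordinal (ap i) | i < k].
  rewrite inE; apply/eqP; rewrite -[RHS]sa.
  by apply: eq_bigr => i _; rewrite tnth_mktuple.
by apply: eq_from_tnth => i; rewrite tnth_map tnth_mktuple.
Qed.

Lemma sorted_multi_indices k p :
  sorted (fun a b : k.-tuplelexi nat => (b <= a)%O) (multi_indices k p).
Proof. exact/sort_sorted/ge_total. Qed.

Lemma map_val_tuple_inj k p :
  injective (map_tuple val : k.-tuple 'I_p.+1 -> k.-tuple nat).
Proof.
by move=> a b /(congr1 val) /= /(inj_map val_inj) /val_inj.
Qed.

Lemma uniq_multi_indices k p : uniq (multi_indices k p).
Proof.
by rewrite sort_uniq map_inj_uniq ?enum_uniq//; exact: map_val_tuple_inj.
Qed.

Lemma size_multi_indices k p : size (multi_indices k p) = tdim k p.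
Proof.
rewrite size_sort size_map -cardE /tdim; case: k => [|k].
  rewrite add0n; case: p => [|p].
    rewrite (eq_card (B := predT)) ?card_tuple// => a.
    by rewrite !inE big_ord0.
  rewrite subn1 /= bin_small// eq_card0// => a.
  by rewrite !inE big_ord0.
rewrite addSn subn1 /=.
have <- : 'C(k + p, k) = 'C(k + p, p).
  by rewrite -[in RHS]bin_sub ?leq_addl// addnK.
rewrite -card_ord_partitions -[in RHS]cardsE.
by apply: eq_card => a; rewrite !inE big_tuple.
Qed.

End MultiIndices.

Section Tensor.
Variable R : realType.

Definition monomial (k : nat) (a : k.-tuple nat) (x : 'cV[R]_k) : R :=
  \prod_(i < k) x i 0 ^+ tnth a i.

Definition weight (k : nat) (p : nat) (a : k.-tuple nat) : R :=
  Num.sqrt (p`!%:R / (\prod_(i < k) (tnth a i)`!)%N%:R).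

Definition tensor_power (k p : nat) (x : 'cV[R]_k) : 'cV[R]_(tdim k p) :=
  \col_i let a := nth (nseq_tuple k 0%N) (multi_indices k p) i in
         weight p a * monomial a x.

(* [xget 0 S] is the element of S when S is a singleton; the two sets below are
   singletons, so the default value 0 is never used. *)
Definition tensor_out (m n p : nat) (C : 'M[R]_(m, n)) :
    'M[R]_(tdim m p, tdim n p) :=
  xget 0 [set M | forall x : 'cV[R]_n,
                    tensor_power p (C *m x) = M *m tensor_power p x].

Definition tensor_dyn (n p : nat) (A : 'M[R]_n) : 'M[R]_(tdim n p) :=
  xget 0 [set M | forall x : R -> 'cV[R]_n, solution A x ->
                    solution M (fun t => tensor_power p (x t))].

End Tensor.

Section Distributions.
Variable R : realType.

(* R^k with its Borel sigma-algebra. *)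
Definition Rvec (k : nat) := g_sigma_algebraType (@open 'cV[R]_k).

Definition distribution_on (k : nat) := probability (Rvec k) R.

Definition same_law (k : nat) (mu nu : set (Rvec k) -> \bar R) : Prop :=
  forall B : set (Rvec k), measurable B -> mu B = nu B.

(* Lebesgue measure on R^(k+1) is the product of the one on R and the one on
   R^k, transported along the identification of R * R^k with R^(k+1). *)
Fixpoint lebesgue_Rvec (k : nat) : set (Rvec k) -> \bar R :=
  match k with
  | 0 => dirac ((0 : 'cV[R]_0) : Rvec 0)
  | k'.+1 => pushforward
      (product_measure1 (@lebesgue_measure R) (@lebesgue_Rvec k'))
      (fun z =>
         (col_mx (z.1)%:M (z.2 : 'cV[R]_k') : 'cV[R]_(1 + k')) : Rvec k'.+1)
  end.

Definition has_density (k : nat) (P : distribution_on k) : Prop :=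
  exists f : Rvec k -> R,
    [/\ measurable_fun setT f,
        forall x, 0 <= f x &
        forall B : set (Rvec k), measurable B ->
          P B = (\int[@lebesgue_Rvec k]_(x in B) (f x)%:E)%E].

Definition euclidean_norm (k : nat) (x : 'cV[R]_k) : R :=
  Num.sqrt (\sum_(i < k) x i 0 ^+ 2).

Definition finite_moments (k : nat) (P : distribution_on k) : Prop :=
  forall p : nat, (\int[P]_x (euclidean_norm x ^+ p)%:E < +oo)%E.

Definition moment (k : nat) (P : distribution_on k) (a : k.-tuple nat) :
    \bar R :=
  (\int[P]_x (monomial a x)%:E)%E.

Definition moment_determinate (k : nat) (P : distribution_on k) : Prop :=
  finite_moments P /\
  forall Q : distribution_on k, finite_moments Q ->
    (forall a : k.-tuple nat, moment Q a = moment P a) -> same_law Q P.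

Definition output_distribution (n m : nat) (A : 'M[R]_n) (C : 'M[R]_(m, n))
    (P0 : distribution_on n) (t : R) : set (Rvec m) -> \bar R :=
  pushforward P0 (fun x : Rvec n => (C *m expmx (t *: A) *m x : Rvec m)).

Definition ensemble_observable (n m : nat) (A : 'M[R]_n) (C : 'M[R]_(m, n))
    (K : set (distribution_on n)) : Prop :=
  forall P' P'' : distribution_on n,
    K P' -> K P'' -> has_density P' -> has_density P'' ->
    (forall t : R, 0 <= t ->
       same_law (output_distribution A C P' t)
                (output_distribution A C P'' t)) ->
    same_law P' P''.

End Distributions.

(* Main.v *)
Require Import Defs.
From mathcomp Require Import all_boot all_order all_algebra.
From mathcomp Require Import all_classical all_reals all_analysis.
From mathcomp Require Import measurable_realfun ring.
From mathcomp Require mpoly.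
Import (canonicals) mpoly.
Set Implicit Arguments.
Unset Strict Implicit.
Unset Printing Implicit Defensive.
Import Order.TTheory GRing.Theory Num.Theory.
Import numFieldNormedType.Exports.
Local Open Scope classical_set_scope.
Local Open Scope ring_scope.

(** Let S be the union of the images of the (C e^{At})^T for t >= 0, and write
    <u, v> for the Euclidean inner product. Everything rests on two facts about
    the tensor powers x^[p]. The weights are chosen so that the multinomial
    theorem reads <x^[p], y^[p]> = <x, y>^p ([tensor_power_dot]), and the
    vectors x^[p] span their space, since distinct monomials are linearly
    independent functions ([tensor_power_total]). Thus v |-> <v, x^[p]>
    identifies the state space of the p-th tensor system with the homogeneous
    polynomial functions of degree p.

    The matrices C^[p] and A_[p] exist because substituting linear forms, or
    differentiating along a linear flow, sends homogeneous polynomials to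
    homogeneous polynomials of the same degree ([tensor_outP],
    [tensor_dynP]). By uniqueness for linear differential equations,
    C^[p] e^{t A_[p]} x^[p] = (C e^{tA} x)^[p] ([tensor_output]), and the two
    facts above turn this into the adjoint formula
      <C^[p] e^{t A_[p]} v, u^[p]> = <v, ((C e^{tA})^T u)^[p]>
    ([tensor_output_adjoint]). As the u^[p] span, the unobservable vectors v
    of the p-th tensor system are exactly the homogeneous forms of degree p that
    vanish on S ([observable_tensorP]).

    The set S contains 0 and is stable under scaling. So when a polynomial
    vanishes on S, then so does each of its homogeneous components; hence S lies
    in a proper variety if and only if some nonzero form of degree p >= 1
    vanishes on it ([not_in_proper_varietyP]). This is the equivalence.

    For ensemble observability, fix s = (C e^{tA})^T u in S. The law of
    <s, x> = <u, C e^{tA} x> is determined by the output law at time t, and its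
    p-th moment is, by the multinomial theorem, the value at s of a form of
    degree p whose coefficients are positive multiples of the moments of the
    initial distribution ([integral_dot_exp]). Two initial distributions with
    the same output laws give forms that agree on S. When S lies in no proper
    variety the forms are equal, so the moments agree, and
    moment-determinacy concludes. *)

(** * Inner product *)

(** Written as a matrix product, so that moving a matrix to the other argument
    is just associativity. *)
Definition dot {R : realType} {k : nat} (u v : 'cV[R]_k) : R := (u^T *m v) 0 0.

Section Dot.
Variable R : realType.
Implicit Types k l : nat.

Lemma dotE k (u v : 'cV[R]_k) : dot u v = \sum_i u i 0 * v i 0.
Proof. by rewrite /dot mxE; apply: eq_bigr => i _; rewrite mxE. Qed.

Lemma dot0l k (v : 'cV[R]_k) : dot 0 v = 0.
Proof. by rewrite /dot trmx0 mul0mx mxE. Qed.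

Lemma dotDl k (u v w : 'cV[R]_k) : dot (u + v) w = dot u w + dot v w.
Proof. by rewrite /dot linearD mulmxDl mxE. Qed.

Lemma dotBl k (u v w : 'cV[R]_k) : dot (u - v) w = dot u w - dot v w.
Proof. by rewrite /dot linearB mulmxBl !mxE. Qed.

Lemma dotZl k c (u v : 'cV[R]_k) : dot (c *: u) v = c * dot u v.
Proof. by rewrite /dot linearZ -scalemxAl mxE. Qed.

Lemma dot_mulmxl k l (M : 'M[R]_(l, k)) (u : 'cV_k) (v : 'cV_l) :
  dot (M *m u) v = dot u (M^T *m v).
Proof. by rewrite /dot trmx_mul mulmxA. Qed.

Lemma dot_mulmxr k l (M : 'M[R]_(l, k)) (u : 'cV_l) (v : 'cV_k) :
  dot u (M *m v) = dot (M^T *m u) v.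
Proof. by rewrite dot_mulmxl trmxK. Qed.

Lemma dot_delta k (i : 'I_k) (v : 'cV[R]_k) : dot (delta_mx i 0) v = v i 0.
Proof.
rewrite dotE (bigD1 i)//= big1 => [|j ji]; last by rewrite mxE (negPf ji) mul0r.
by rewrite addr0 mxE !eqxx mul1r.
Qed.

End Dot.

(** * The multinomial theorem *)

Section MultinomialTheorem.
Variable F : numFieldType.

(** Truncated exponential generating function: the functional equation
    e^a e^b = e^{a + b}, read on coefficients up to p, is the binomial theorem,
    while expanding the product of several such polynomials produces the
    multinomial sum. *)
Let exp_poly p (z : F) : {poly F} := \poly_(j < p.+1) (z ^+ j / j`!%:R).

Let coef_prod_exp_poly p (I : Type) (r : seq I) (z : I -> F) (j : nat) :
  (j <= p)%N ->
  (\prod_(i <- r) exp_poly p (z i))`_j = (\sum_(i <- r) z i) ^+ j / j`!%:R.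
Proof.
elim: r j => [|i r IH] j jp.
  rewrite !big_nil coef1 expr0n; case: j jp => [|j] _; last by rewrite mul0r.
  by rewrite fact0 divr1.
rewrite !big_cons coefM [z i + _]addrC exprDn mulr_suml; apply: eq_bigr => l _.
have lj : (l <= j)%N by rewrite -ltnS.
rewrite coef_poly ltnS (leq_trans lj jp) IH ?(leq_trans (leq_subr _ _) jp)//.
have fact_neq0 m : (m`!%:R : F) != 0 by rewrite pnatr_eq0 -lt0n fact_gt0.
rewrite -(bin_fact lj) !natrM -mulr_natr.
have binn0 : ('C(j, l)%:R : F) != 0 by rewrite pnatr_eq0 -lt0n bin_gt0.
by field; rewrite !fact_neq0 binn0.
Qed.

Lemma multinomial_expansion k p (z : 'I_k -> F) :
  (\sum_i z i) ^+ p =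
  \sum_(a <- multi_indices k p)
     p`!%:R / (\prod_i (tnth a i)`!)%N%:R * \prod_i z i ^+ tnth a i.
Proof.
have pf0 : (p`!%:R : F) != 0 by rewrite pnatr_eq0 -lt0n fact_gt0.
have -> : (\sum_i z i) ^+ p = p`!%:R * (\prod_i exp_poly p (z i))`_p.
  by rewrite coef_prod_exp_poly// mulrC divfK.
have -> : \prod_i exp_poly p (z i) = \sum_(f : {ffun 'I_k -> 'I_p.+1})
    (\prod_i (z i ^+ f i / (f i)`!%:R)) *: 'X^(\sum_i f i).
  under eq_bigr do rewrite /exp_poly poly_def.
  rewrite bigA_distr_bigA; apply: eq_bigr => f _.
  by rewrite scaler_prod expr_sum.
rewrite coef_sum mulr_sumr /multi_indices (perm_big _ (permEl (perm_sort _ _))).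
rewrite big_map big_enum_cond /=.
rewrite (reindex (fun a : k.-tuple 'I_p.+1 => [ffun i => tnth a i]))/=;
  last first.
  exists (fun f : {ffun 'I_k -> 'I_p.+1} => [tuple f i | i < k]) => [a _|f _].
    by apply: eq_from_tnth => i; rewrite tnth_mktuple ffunE.
  by apply/ffunP => i; rewrite ffunE tnth_mktuple.
rewrite [RHS]big_mkcond/=; apply: eq_bigr => a _.
rewrite coefZ coefXn inE eq_sym; under eq_bigr do rewrite ffunE.
under [X in _ * (_ * (X == _)%:R)]eq_bigr do rewrite ffunE.
case: eqP => _; last by rewrite !mulr0.
rewrite mulr1 big_split/= mulrA mulrAC; congr (_ * _ * _).
  by rewrite natr_prod -prodfV; apply: eq_bigr => i _; rewrite tnth_map.
by apply: eq_bigr => i _; rewrite tnth_map.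
Qed.
End MultinomialTheorem.

(** * Tensor powers *)

Section TensorPower.
Variable R : realType.
Implicit Types k p : nat.

(** The default tuple is never reached: the index always comes from an ordinal
    bounded by the number of multi-indices. *)
Definition multi_index k p (i : nat) : k.-tuple nat :=
  nth (nseq_tuple k 0%N) (multi_indices k p) i.

Lemma tensor_powerE k p (x : 'cV[R]_k) (i : 'I_(tdim k p)) :
  tensor_power p x i 0 =
  weight R p (multi_index k p i) * monomial (multi_index k p i) x.
Proof. by rewrite mxE. Qed.

Lemma big_multi_index k p (F : k.-tuple nat -> R) :
  \sum_(i < tdim k p) F (multi_index k p i) = \sum_(a <- multi_indices k p) F a.
Proof.
by rewrite (big_nth (nseq_tuple k 0%N)) size_multi_indices big_mkord.
Qed.

Lemma degree_multi_index k p (i : 'I_(tdim k p)) :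
  (\sum_(j < k) tnth (multi_index k p i) j = p)%N.
Proof.
by apply/eqP; rewrite -mem_multi_indices mem_nth// size_multi_indices.
Qed.

Lemma multi_index_surj k p (a : k.-tuple nat) : (\sum_(j < k) tnth a j = p)%N ->
  exists i : 'I_(tdim k p), multi_index k p i = a.
Proof.
move/eqP; rewrite -mem_multi_indices => ap.
have lt : (index a (multi_indices k p) < tdim k p)%N.
  by rewrite -size_multi_indices index_mem.
by exists (Ordinal lt); rewrite /multi_index nth_index.
Qed.

Lemma weight_gt0 k p (a : k.-tuple nat) : 0 < weight R p a.
Proof.
rewrite sqrtr_gt0 divr_gt0// ltr0n ?fact_gt0//.
by rewrite prodn_gt0// => i; rewrite fact_gt0.
Qed.

Lemma weight_sqr k p (a : k.-tuple nat) :
  weight R p a ^+ 2 = p`!%:R / (\prod_(i < k) (tnth a i)`!)%N%:R.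
Proof. by rewrite sqr_sqrtr// divr_ge0. Qed.

(** The multinomial theorem for the numbers x_i y_i; the square of the weight is
    the multinomial coefficient. *)
Lemma tensor_power_dot k p (x y : 'cV[R]_k) :
  dot (tensor_power p x) (tensor_power p y) = dot x y ^+ p.
Proof.
rewrite dotE [dot x y]dotE multinomial_expansion -big_multi_index.
apply: eq_bigr => i _; rewrite !tensor_powerE -weight_sqr /monomial.
under [in RHS]eq_bigr do rewrite exprMn.
by rewrite big_split/= expr2; ring.
Qed.

Lemma base_expansion_inj (B k : nat) (f g : 'I_k -> nat) :
  (forall i, f i < B)%N -> (forall i, g i < B)%N ->
  (\sum_(i < k) B ^ i * f i = \sum_(i < k) B ^ i * g i)%N -> f =1 g.
Proof.
elim: k f g => [|k IH] f g fB gB; first by move=> _ [].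
rewrite !big_ord_recl !expn0 !mul1n.
have shift (h : 'I_k.+1 -> nat) : (\sum_(i < k) B ^ bump 0 i * h (lift ord0 i) =
    B * \sum_(i < k) B ^ i * h (lift ord0 i))%N.
  by rewrite big_distrr/=; apply: eq_bigr => i _; rewrite /bump expnS mulnA.
rewrite !shift => e.
have B0 : (0 < B)%N by apply: leq_ltn_trans (fB ord0).
have e0 : f ord0 = g ord0.
  move/(congr1 (modn^~ B)): e.
  by rewrite ![(_ + B * _)%N]addnC ![(B * _)%N]mulnC !modnMDl !modn_small.
move/eqP: e; rewrite e0 eqn_add2l eqn_pmul2l// => /eqP e i.
have [j ->|->//] := unliftP ord0 i.
exact: (IH (fun j => f (lift ord0 j)) (fun j => g (lift ord0 j))).
Qed.

Lemma poly_fun_eq0 (q : {poly R}) : (forall y, q.[y] = 0) -> q = 0.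
Proof.
move=> q0; apply/eqP; apply: contraT => qn0.
have /max_poly_roots : q != 0 by [].
move=> /(_ [seq i%:R | i <- iota 0 (size q)]).
rewrite size_map size_iota ltnn => -> //; last first.
  by rewrite map_inj_uniq ?iota_uniq// => i j /eqP; rewrite eqr_nat => /eqP.
by apply/allP => y _; rewrite /root q0.
Qed.

(** Kronecker substitution: at the point with coordinates y^(B^i), B = p + 1,
    the monomial of exponent a takes the value y^(sum a_i B^i). Since the
    exponents a_i are less than B, distinct monomials give distinct powers of y,
    so a combination that vanishes at all these points has zero coefficients. *)
Lemma tensor_power_total k p (v : 'cV[R]_(tdim k p)) :
  (forall x, dot v (tensor_power p x) = 0) -> v = 0.
Proof.
move=> v0.
pose N (a : k.-tuple nat) := (\sum_(i < k) p.+1 ^ i * tnth a i)%N.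
pose q : {poly R} := \sum_(i < tdim k p)
  (v i 0 * weight R p (multi_index k p i)) *: 'X^(N (multi_index k p i)).
have q0 : q = 0.
  apply: poly_fun_eq0 => y.
  rewrite -[RHS](v0 (\col_i (y ^+ (p.+1 ^ i)))) dotE horner_sum.
  apply: eq_bigr => i _; rewrite hornerZ hornerXn tensor_powerE mulrA.
  congr (_ * _); rewrite /monomial expr_sum; apply: eq_bigr => j _.
  by rewrite mxE exprM.
have Ninj (i j : 'I_(tdim k p)) :
    N (multi_index k p i) = N (multi_index k p j) -> i = j.
  have bound (l : 'I_(tdim k p)) m : (tnth (multi_index k p l) m < p.+1)%N.
    by rewrite ltnS -[leqRHS](degree_multi_index l) (bigD1 m)//= leq_addr.
  move=> /(base_expansion_inj (bound i) (bound j)) eij; apply/val_inj/eqP.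
  rewrite -(@nth_uniq _ (nseq_tuple k 0%N) (multi_indices k p));
    rewrite ?size_multi_indices ?uniq_multi_indices ?ltn_ord//.
  by apply/eqP/eq_from_tnth/eij.
apply/colP => i; rewrite [RHS]mxE.
move/(congr1 (fun r : {poly R} => r`_(N (multi_index k p i)))): q0.
rewrite coef0 coef_sum (bigD1 i)//= big1 => [|j ji].
  rewrite coefZ coefXn eqxx mulr1 addr0 => /eqP.
  by rewrite mulf_eq0 (gt_eqF (weight_gt0 _ _)) orbF => /eqP.
rewrite coefZ coefXn; case: eqP => [/Ninj ij|]; last by rewrite mulr0.
by rewrite ij eqxx in ji.
Qed.

End TensorPower.

(** * Homogeneous polynomial functions *)

(** Homogeneous polynomial functions of degree p, given by their coefficients
    on the weighted monomials. *)
Definition homogeneous {R : realType} {k : nat} (p : nat) (f : 'cV[R]_k -> R) :=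
  exists v : 'cV[R]_(tdim k p), forall x, f x = dot v (tensor_power p x).

Section Homogeneous.
Variables (R : realType) (k : nat).
Implicit Types (f g : 'cV[R]_k -> R).

Lemma homogeneous_ext p f g : f =1 g -> homogeneous p f -> homogeneous p g.
Proof. by move=> fg [v fv]; exists v => x; rewrite -fg. Qed.

Lemma homogeneous0 p : @homogeneous R k p (fun=> 0).
Proof. by exists 0 => x; rewrite dot0l. Qed.

Lemma homogeneousD p f g : homogeneous p f -> homogeneous p g ->
  homogeneous p (fun x => f x + g x).
Proof. by move=> [u fu] [v gv]; exists (u + v) => x; rewrite dotDl fu gv. Qed.

Lemma homogeneousZ p c f : homogeneous p f -> homogeneous p (fun x => c * f x).
Proof. by move=> [u fu]; exists (c *: u) => x; rewrite dotZl fu. Qed.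

Lemma homogeneous_sum p (I : Type) (r : seq I) (P : pred I)
    (f : I -> 'cV[R]_k -> R) :
  (forall i, P i -> homogeneous p (f i)) ->
  homogeneous p (fun x => \sum_(i <- r | P i) f i x).
Proof.
move=> fh; elim: r => [|i r IH].
  by apply: homogeneous_ext (homogeneous0 p) => x; rewrite big_nil.
case Pi: (P i); under eq_fun do rewrite big_cons Pi; last exact: IH.
by apply: homogeneousD => //; exact: fh.
Qed.

Lemma homogeneous_monomial p (a : k.-tuple nat) :
  (\sum_i tnth a i = p)%N -> homogeneous p (@monomial R k a).
Proof.
move=> /multi_index_surj[i <-].
exists ((weight R p (multi_index k p i))^-1 *: delta_mx i 0) => x.
by rewrite dotZl dot_delta tensor_powerE mulKf// gt_eqF// weight_gt0.
Qed.

Lemma homogeneousM p q f g : homogeneous p f -> homogeneous q g ->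
  homogeneous (p + q) (fun x => f x * g x).
Proof.
move=> [u fu] [v gv].
pose ab i j := [tuple
  (tnth (multi_index k p i) l + tnth (multi_index k q j) l)%N | l < k].
pose h (x : 'cV[R]_k) := \sum_i \sum_j
  (u i 0 * weight R p (multi_index k p i) *
   (v j 0 * weight R q (multi_index k q j))) *
  monomial (ab i j) x.
apply: (@homogeneous_ext _ h).
  move=> x; rewrite fu gv !dotE mulr_suml; apply: eq_bigr => i _.
  rewrite mulr_sumr; apply: eq_bigr => j _; rewrite !tensor_powerE.
  have -> : monomial (ab i j) x =
      monomial (multi_index k p i) x * monomial (multi_index k q j) x.
    by rewrite -big_split/=; apply: eq_bigr => l _; rewrite tnth_mktuple exprD.
  by ring.
apply: homogeneous_sum => i _; apply: homogeneous_sum => j _.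
apply/homogeneousZ/homogeneous_monomial.
under eq_bigr do rewrite tnth_mktuple.
by rewrite big_split/= !degree_multi_index.
Qed.

Lemma homogeneous1 : @homogeneous R k 0 (fun=> 1).
Proof.
have a0 : (\sum_i tnth (nseq_tuple k 0) i = 0)%N.
  by rewrite big1// => i _; rewrite tnth_nseq.
apply: homogeneous_ext (homogeneous_monomial a0) => x.
by rewrite /monomial big1// => i _; rewrite tnth_nseq expr0.
Qed.

Lemma homogeneous_dot (u : 'cV[R]_k) : homogeneous 1 (dot u).
Proof.
by exists (tensor_power 1 u) => x; rewrite tensor_power_dot expr1.
Qed.

Lemma homogeneous_coord (i : 'I_k) : homogeneous 1 (fun x : 'cV[R]_k => x i 0).
Proof.
apply: homogeneous_ext (homogeneous_dot (delta_mx i 0)) => x.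
exact: dot_delta.
Qed.

(** Used with two different properties [G]: homogeneity after a linear
    substitution, and having a homogeneous derivative along a linear flow. *)
Lemma monomial_ind (G : nat -> ('cV[R]_k -> R) -> Prop)
  (G1 : G 0%N (fun=> 1))
  (Gcoord : forall i, G 1%N (fun x => x i 0))
  (GM : forall p q f g, G p f -> G q g -> G (p + q)%N (fun x => f x * g x))
  (a : k.-tuple nat) : G (\sum_i tnth a i)%N (@monomial R k a).
Proof.
rewrite /monomial; elim: (index_enum 'I_k) => [|i r IH].
  by rewrite big_nil; under eq_fun do rewrite big_nil.
rewrite big_cons (_ : (fun x : 'cV[R]_k => _) =
    (fun x => x i 0 ^+ tnth a i * \prod_(j <- r) x j 0 ^+ tnth a j));
  last first.
  by apply/funext => x; rewrite big_cons.
apply: (GM _ _ _ _ _ IH); elim: (tnth a i) => [|d IHd].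
  by under eq_fun do rewrite expr0.
by under eq_fun do rewrite exprS; rewrite -add1n; apply: GM.
Qed.

End Homogeneous.

(** * The matrices of the tensor systems *)

Section TensorSystems.
Variable R : realType.

Lemma homogeneous_rows k p q (f : 'I_q -> 'cV[R]_k -> R) :
  (forall i, homogeneous p (f i)) ->
  exists M : 'M[R]_(q, tdim k p),
    forall x, \col_i f i x = M *m tensor_power p x.
Proof.
move=> /choice[v fv]; exists (\matrix_(i, j) v i j 0) => x.
apply/colP => i; rewrite !mxE fv dotE.
by apply: eq_bigr => j _; rewrite !mxE.
Qed.

(** Each coordinate of (C x)^[p] is a product of p linear forms in x, hence
    homogeneous of degree p; its coefficients are a row of C^[p]. *)
Lemma tensor_outP m n p (C : 'M[R]_(m, n)) (x : 'cV[R]_n) :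
  tensor_power p (C *m x) = tensor_out p C *m tensor_power p x.
Proof.
move: x; rewrite /tensor_out; apply: (@xgetPex _ 0 [set M |
  forall x, tensor_power p (C *m x) = M *m tensor_power p x]).
have [|M MC] := @homogeneous_rows n p (tdim m p)
    (fun i x => tensor_power p (C *m x) i 0).
  move=> i; under eq_fun do rewrite tensor_powerE.
  apply: homogeneousZ.
  rewrite -[p in homogeneous p](degree_multi_index i).
  apply: (@monomial_ind R m (fun p f => homogeneous p (fun x => f (C *m x)))).
  - exact: homogeneous1.
  - move=> j.
    apply: homogeneous_ext (homogeneous_dot (C^T *m delta_mx j 0)) => x0.
    by rewrite -dot_mulmxr dot_delta.
  - by move=> q r f g; exact: homogeneousM.
exists M => x0; rewrite -MC.
by apply/colP => i; rewrite mxE.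
Qed.

(** The derivative g of f along the vector field A x is required to be
    homogeneous of the same degree p; this is what makes the induction on
    monomials work. *)
Definition differentiable_along n (A : 'M[R]_n) p (f : 'cV[R]_n -> R) :=
  homogeneous p f /\ exists2 g : 'cV[R]_n -> R, homogeneous p g &
  forall x, solution A x ->
    forall t : R, is_derive t 1 (fun s => f (x s)) (g (x t)).

Lemma is_derive_mxP m n (f : R -> 'M[R]_(m, n)) (t : R) (df : 'M[R]_(m, n)) :
  is_derive t 1 f df <-> forall i j, is_derive t 1 (fun s => f s i j) (df i j).
Proof.
split.
  move=> fdf i j; have Df : derivable f t 1 by case: fdf.
  apply: DeriveDef; first by move/derivable_mxP : Df; exact.
  by rewrite -[df]derive_val (derive_mx Df) mxE.
move=> fdf; have Df : derivable f t 1.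
  by apply/derivable_mxP => i j; have [] := fdf i j.
apply: DeriveDef => //; rewrite (derive_mx Df).
by apply/matrixP => i j; rewrite mxE derive_val.
Qed.

(** By the product rule, the derivative of a monomial of degree p along a
    solution is a homogeneous polynomial of degree p in the state; its
    coefficients are a row of A_[p]. *)
Lemma tensor_dynP n p (A : 'M[R]_n) (x : R -> 'cV[R]_n) :
  solution A x -> solution (tensor_dyn p A) (fun t => tensor_power p (x t)).
Proof.
move: x; rewrite /tensor_dyn; apply: (@xgetPex _ 0 [set M |
  forall x, solution A x -> solution M (fun t => tensor_power p (x t))]).
have along (a : n.-tuple nat) :
    differentiable_along A (\sum_i tnth a i) (monomial a).
  apply: monomial_ind.
  - split; first exact: homogeneous1.
    exists (fun=> 0) => [|y _ t]; first exact: homogeneous0.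
    exact: is_derive_cst.
  - move=> i; split; first exact: homogeneous_coord.
    exists (fun y => dot (A^T *m delta_mx i 0) y) => [|y Ay t].
      exact: homogeneous_dot.
    rewrite -dot_mulmxr dot_delta.
    by move/is_derive_mxP : (Ay t); exact.
  - move=> q r f g [hf [f' hf' ff']] [hg [g' hg' gg']].
    split; first exact: homogeneousM.
    exists (fun y => f' y * g y + f y * g' y) => [|y Ay t].
      by apply: homogeneousD; exact: homogeneousM.
    have := is_deriveM (ff' _ Ay t) (gg' _ Ay t).
    by move/is_derive_eq; apply; rewrite addrC; congr (_ + _); exact: mulrC.
have /choice[g gP] : forall i : 'I_(tdim n p), exists g : 'cV[R]_n -> R,
    homogeneous p g /\ forall y, solution A y -> forall t : R,
      is_derive t 1 (fun s => tensor_power p (y s) i 0) (g (y t)).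
  move=> i; have [_ [g gh gP]] := along (multi_index n p i).
  exists (fun y => weight R p (multi_index n p i) * g y); split.
    by apply: homogeneousZ; rewrite degree_multi_index in gh.
  move=> y Ay t; under eq_fun do rewrite tensor_powerE.
  exact: (is_deriveZ _ (gP y Ay t)).
have [M MA] := homogeneous_rows (fun i => (gP i).1).
exists M => y Ay t; apply/is_derive_mxP => i j; rewrite ord1 -MA mxE.
exact: (gP i).2.
Qed.

End TensorSystems.

(** * The matrix exponential and linear differential equations *)

Section MatrixExponential.
Variable R : realType.

Lemma cvg_mx m n (u : nat -> 'M[R]_(m, n)) (L : 'M[R]_(m, n)) :
  (forall i j, u r i j @[r --> \oo] --> L i j) -> u r @[r --> \oo] --> L.
Proof.
move=> uL; apply/cvgrPdist_le => /= e e0; near=> r.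
rewrite [leLHS]/Num.Def.normr/= mx_normrE (bigmax_le _ (ltW e0))//= => i _.
rewrite !mxE; move: i; near: r; apply: filter_forall => /= i.
exact: ((cvgrPdist_le _ _).1 (uL i.1 i.2)).
Unshelve. all: by end_near. Qed.

Lemma is_derive_mulmx m n p (f : R -> 'M[R]_(m, n)) (g : R -> 'M[R]_(n, p))
    (t : R) df dg :
  is_derive t 1 f df -> is_derive t 1 g dg ->
  is_derive t 1 (fun s => f s *m g s) (df *m g t + f t *m dg).
Proof.
move=> /is_derive_mxP fdf /is_derive_mxP gdg; apply/is_derive_mxP => i j.
have -> : (fun s => (f s *m g s) i j) =
    \sum_(l < n) ((fun s => f s i l) * (fun s => g s l j)).
  by apply/funext => s; rewrite mxE fct_sumE.
have := is_derive_sum (fun l => is_deriveM (fdf i l) (gdg l j)).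
move/is_derive_eq; apply; rewrite !mxE -big_split/=; apply: eq_bigr => l _.
by rewrite addrC; congr (_ + _); exact: mulrC.
Qed.

Section Expmx.
Variables (k : nat) (F : 'M[R]_k).

(** A submultiplicative norm, for which it is elementary to bound the entries
    of powers. *)
Let entry_sum (G : 'M[R]_k) : R := \sum_a \sum_b `|G a b|.

Let entry_mul_exp_le (G : 'M[R]_k) i a b :
  `|(G *m F ^+ i) a b| <= entry_sum G * entry_sum F ^+ i.
Proof.
have entry_le (H : 'M[R]_k) c d : `|H c d| <= entry_sum H.
  rewrite /entry_sum (bigD1 c)//= (bigD1 d)//= -addrA lerDl addr_ge0//.
    exact: sumr_ge0.
  by apply: sumr_ge0 => *; exact: sumr_ge0.
elim: i a b => [|i IH] a b; first by rewrite !expr0 mulmx1 mulr1.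
rewrite exprSr mulmxA mxE (le_trans (ler_norm_sum _ _ _))//.
under eq_bigr do rewrite normrM.
apply: (@le_trans _ _ (\sum_l entry_sum G * entry_sum F ^+ i * `|F l b|)).
  by apply: ler_sum => l _; rewrite ler_wpM2r.
rewrite -mulr_sumr exprSr mulrA ler_wpM2l//.
  by rewrite (le_trans _ (IH a b)).
by apply: ler_sum => l _; rewrite (bigD1 b)//= lerDl sumr_ge0.
Qed.

(** Coefficients of the power series in x of an entry of G e^{xF}. The factor G
    makes the family stable under differentiation, which replaces G by GF; the
    convergence of all derivatives is then a single statement. *)
Let expmx_coef (G : 'M[R]_k) a b (i : nat) : R := (G *m F ^+ i) a b / i`!%:R.

Let cvg_expmx_coef G a b x : cvgn (pseries (expmx_coef G a b) x).
Proof.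
apply: normed_cvg.
have entry_sum_ge0 (H : 'M[R]_k) : 0 <= entry_sum H.
  by apply: sumr_ge0 => c _; exact: sumr_ge0.
apply: (@series_le_cvg _ _
  (entry_sum G *: exp_coeff (entry_sum F * `|x|))) => [i|i|i|].
- exact: normr_ge0.
- by rewrite mulr_ge0// exp_coeff_ge0// mulr_ge0.
- have -> : (entry_sum G *: exp_coeff (entry_sum F * `|x|)) i =
      entry_sum G * entry_sum F ^+ i * (i`!%:R^-1 * `|x| ^+ i).
    by rewrite /exp_coeff /GRing.scale/= /GRing.scale/= exprMn; ring.
  rewrite /= /expmx_coef !normrM normfV normr_nat normrX -mulrA.
  by rewrite ler_wpM2r ?entry_mul_exp_le// mulr_ge0// exprn_ge0.
- exact: is_cvg_seriesZ (is_cvg_series_exp_coeff _).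
Qed.

Let diffs_expmx_coef G a b :
  pseries_diffs (expmx_coef G a b) = expmx_coef (G *m F) a b.
Proof.
apply/funext => i; rewrite /pseries_diffs /expmx_coef exprS mulmxA factS natrM.
by rewrite invfM mulrCA mulVKf.
Qed.

Let derive_expmx_coef G a b (x : R) :
  is_derive x 1 (fun x => limn (pseries (expmx_coef G a b) x))
    (limn (pseries (expmx_coef (G *m F) a b) x)).
Proof.
rewrite -diffs_expmx_coef; apply: (@pseries_snd_diffs _ _ (`|x| + 1)).
- exact: cvg_expmx_coef.
- by rewrite diffs_expmx_coef; exact: cvg_expmx_coef.
- by rewrite !diffs_expmx_coef; exact: cvg_expmx_coef.
- by rewrite [ltRHS]ger0_norm ?ltrDl ?addr_ge0.
Qed.

Let expr_scalemx (x : R) i : (x *: F) ^+ i = x ^+ i *: F ^+ i.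
Proof.
elim: i => [|i IH]; first by rewrite !expr0 scale1r.
by rewrite !exprS IH -!mulmxE -scalemxAr -scalemxAl scalerA mulrC.
Qed.

Let expmxE x : expmx (x *: F) =
  \matrix_(a, b) limn (pseries (expmx_coef 1%:M a b) x).
Proof.
apply: cvg_lim => //; apply: cvg_mx => a b; rewrite mxE.
rewrite (_ : (fun _ => _) = pseries (expmx_coef 1%:M a b) x); last first.
  apply/funext => r; rewrite /pseries /series/= summxE; apply: eq_bigr => i _.
  by rewrite expr_scalemx !mxE /expmx_coef mul1mx; ring.
exact: cvg_expmx_coef.
Qed.

Let lim_expmx_coef_mull G x a b :
  limn (pseries (expmx_coef G a b) x) = (G *m expmx (x *: F)) a b.
Proof.
apply: cvg_lim => //; rewrite expmxE mxE.
rewrite (_ : pseries _ _ =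
    (fun r => \sum_l G a l * pseries (expmx_coef 1%:M l b) x r)); last first.
  apply/funext => r; rewrite /pseries /series/=.
  under [RHS]eq_bigr do rewrite mulr_sumr.
  rewrite exchange_big/=; apply: eq_bigr => i _.
  rewrite /expmx_coef mxE !mulr_suml; apply: eq_bigr => l _.
  by rewrite mul1mx; ring.
apply: (@cvg_big R _ +%R 0 xpredT add_continuous) => l _.
by rewrite mxE; apply: cvgMl_tmp; exact: cvg_expmx_coef.
Qed.

Lemma is_derive_expmx (t : R) :
  is_derive t 1 (fun s => expmx (s *: F)) (F *m expmx (t *: F)).
Proof.
apply/is_derive_mxP => a b; rewrite -lim_expmx_coef_mull.
rewrite -[in X in is_derive _ _ _ X](mul1mx F).
under eq_fun do rewrite expmxE mxE.
exact: derive_expmx_coef.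
Qed.

Lemma expmx_comm (t : R) : F *m expmx (t *: F) = expmx (t *: F) *m F.
Proof.
apply/matrixP => a b; rewrite -lim_expmx_coef_mull; apply: cvg_lim => //.
rewrite expmxE mxE.
rewrite (_ : pseries _ _ =
    (fun r => \sum_l pseries (expmx_coef 1%:M a l) t r * F l b)); last first.
  apply/funext => r; rewrite /pseries /series/=.
  under [RHS]eq_bigr do rewrite mulr_suml.
  rewrite exchange_big/=; apply: eq_bigr => i _.
  rewrite /expmx_coef mul1mx (_ : F *m F ^+ i = F ^+ i *m F); last first.
    by rewrite -[LHS]exprS -[RHS]exprSr.
  by rewrite mxE !mulr_suml; apply: eq_bigr => l _; ring.
apply: (@cvg_big R _ +%R 0 xpredT add_continuous) => l _.
by rewrite mxE; apply: cvgMr_tmp; exact: cvg_expmx_coef.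
Qed.

Lemma expmx0 : expmx (0 *: F) = 1%:M.
Proof.
apply: cvg_lim => //; rewrite -cvg_shiftS /=.
rewrite (_ : (fun _ => _) = cst 1%:M); first exact: cvg_cst.
apply/funext => r; rewrite /series/= big_nat_recl//= big1 ?addr0.
  by rewrite expr0 fact0 invr1 scale1r.
by move=> i _; rewrite scale0r expr0n/= scaler0.
Qed.

End Expmx.

Lemma solution_expmx k (M : 'M[R]_k) (x0 : 'cV[R]_k) :
  solution M (fun t => expmx (t *: M) *m x0).
Proof.
move=> t.
have := is_derive_mulmx (is_derive_expmx M t) (is_derive_cst x0 t 1).
by move/is_derive_eq; apply; rewrite mulmx0 addr0 mulmxA.
Qed.

(** If z' = M z, then s |-> e^{(t - s) M} z(s) has zero derivative, so its
    values at s = t and at s = 0 agree. *)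
Lemma solution_unique k (M : 'M[R]_k) (z : R -> 'cV[R]_k) (t : R) :
  solution M z -> z t = expmx (t *: M) *m z 0.
Proof.
move=> Mz; apply/colP => i.
pose w s := (expmx ((t - s) *: M) *m z s) i 0.
have -> : z t i 0 = w t by rewrite /w subrr expmx0 mul1mx.
have -> : (expmx (t *: M) *m z 0) i 0 = w 0 by rewrite /w subr0.
apply: is_derive_0_is_cst => s.
have dE : is_derive s 1 (fun s => expmx ((t - s) *: M))
    (- (expmx ((t - s) *: M) *m M)).
  apply/is_derive_mxP => a b.
  have /is_derive_mxP/(_ a b) h := is_derive_expmx M (t - s).
  have dts : is_derive s 1 (fun s : R => t - s) (- 1).
    have := is_deriveB (is_derive_cst t s 1) (is_derive_id s (1 : R)).
    by rewrite sub0r.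
  have := @is_derive1_comp R (fun s => expmx (s *: M) a b)
    (fun s => t - s) s _ _ h dts.
  by move/is_derive_eq; apply; rewrite mulrN1 expmx_comm [RHS]mxE.
have /is_derive_mxP/(_ i 0) := is_derive_mulmx dE (Mz s).
by move/is_derive_eq; apply; rewrite mulNmx mulmxA addNr mxE.
Qed.

End MatrixExponential.

(** * Varieties and homogeneous forms *)

Section Cones.
Variables (R : realType) (k : nat).

Lemma tensor_powerZ p c (x : 'cV[R]_k) :
  tensor_power p (c *: x) = c ^+ p *: tensor_power p x.
Proof.
apply/colP => i; rewrite [RHS]mxE !tensor_powerE mulrCA; congr (_ * _).
rewrite /monomial -[X in c ^+ X](degree_multi_index i) expr_sum -big_split/=.
by apply: eq_bigr => j _; rewrite mxE exprMn.
Qed.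

Lemma algebraic_variety_form p (v : 'cV[R]_(tdim k p)) :
  algebraic_variety [set x | dot v (tensor_power p x) = 0].
Proof.
exists (\sum_i (v i 0 * weight R p (multi_index k p i)) *:
          mpoly.mpolyX R (mpoly.Multinom (multi_index k p i))).
congr mkset; apply/funext => x; congr (_ = _).
rewrite dotE raddf_sum; apply: eq_bigr => i _ /=.
by rewrite mpoly.mevalZ mpoly.mevalX tensor_powerE mulrA.
Qed.

Lemma form_eq0_of_not_in_proper_variety (S : set 'cV[R]_k) p
    (v : 'cV[R]_(tdim k p)) :
  ~ in_proper_algebraic_variety S ->
  (forall s, S s -> dot v (tensor_power p s) = 0) -> v = 0.
Proof.
move=> SN vS; apply: contrapT => vN0; apply: SN.
exists [set x | dot v (tensor_power p x) = 0]; split=> //; split.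
  exact: algebraic_variety_form.
move=> vT; apply: vN0; apply: tensor_power_total => x.
by have : [set: 'cV[R]_k] x by []; rewrite -vT.
Qed.

(** If f vanishes on the cone S and y lies in S, then c |-> f (c y) is a
    polynomial in c that vanishes identically, and its coefficients are the
    values at y of the homogeneous components of f. In degree 0 the component
    is constant and vanishes at 0, hence the restriction to p >= 1. *)
Lemma not_in_proper_varietyP (S : set 'cV[R]_k) :
  S 0 -> (forall c s, S s -> S (c *: s)) ->
  ~ in_proper_algebraic_variety S <->
  forall p, (1 <= p)%N -> forall v : 'cV[R]_(tdim k p),
    (forall s, S s -> dot v (tensor_power p s) = 0) -> v = 0.
Proof.
move=> S0 SZ; split=> [SN p _ v vS|HS [V [[[f ->] fT] Sf]]].
  exact: form_eq0_of_not_in_proper_variety SN vS.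
apply: fT; apply/seteqP; split=> // x _ /=.
pose term (m : mpoly.multinom k) (y : 'cV[R]_k) :=
  mpoly.mcoeff m f * \prod_i y i 0 ^+ mpoly.fun_of_multinom m i.
(* q y is the polynomial c |-> f (c y); its coefficient of degree p, as a
   function of y, is the homogeneous component of degree p of f *)
pose q y : {poly R} := \sum_(m <- mpoly.msupp f) term m y *: 'X^(mpoly.mdeg m).
have qE y c : (q y).[c] = mpoly.meval (fun i => (c *: y) i 0) f.
  rewrite mpoly.mevalE horner_sum; apply: eq_bigr => m _.
  rewrite hornerZ hornerXn /term -mulrA; congr (_ * _).
  rewrite mpoly.mdegE expr_sum -big_split/=; apply: eq_bigr => i _.
  by rewrite mxE exprMn mulrC.
have coef_homogeneous p : homogeneous p (fun y => (q y)`_p).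
  apply: (@homogeneous_ext _ _ _ (fun y =>
    \sum_(m <- mpoly.msupp f | mpoly.mdeg m == p) term m y)).
    move=> y; rewrite coef_sum big_mkcond; apply: eq_bigr => m _.
    by rewrite coefZ coefXn eq_sym; case: eqP => _; rewrite ?mulr1 ?mulr0.
  apply: homogeneous_sum => m /eqP mp; apply: homogeneousZ.
  apply: (@homogeneous_monomial _ _ p (mpoly.multinom_val m)).
  by rewrite -mp mpoly.mdegE.
have coef0S s p : S s -> (q s)`_p = 0.
  move=> Ss; rewrite (poly_fun_eq0 (q := q s)) ?coef0// => c.
  by rewrite qE; exact/Sf/SZ.
suff : q x = 0 by move=> q0; have := qE x 1; rewrite q0 horner0 scale1r.
apply/polyP => p; rewrite coef0; have [v vq] := coef_homogeneous p.
case: p v vq => [|p] v vq; last first.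
  by rewrite vq (HS p.+1 _ v) ?dot0l// => s Ss; rewrite -vq coef0S.
(* 0 ^+ 0 = 1, so scaling x by 0 leaves the tensor power of degree 0 alone *)
rewrite vq -[tensor_power 0 x]scale1r -(expr0 0) -tensor_powerZ scale0r.
by rewrite -vq coef0S.
Qed.

End Cones.

(** * Observability of the tensor systems *)

Section Observability.
Variables (R : realType) (n m : nat) (A : 'M[R]_n) (C : 'M[R]_(m, n)).

(** Both e^{tA} x, raised to the tensor power p, and e^{t A_[p]} x^[p] solve the
    linear equation of A_[p] with initial value x^[p]. *)
Lemma tensor_output p t (x : 'cV[R]_n) :
  tensor_power p (C *m expmx (t *: A) *m x) =
  tensor_out p C *m expmx (t *: tensor_dyn p A) *m tensor_power p x.
Proof.
rewrite -mulmxA tensor_outP -mulmxA; congr (_ *m _).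
rewrite (solution_unique t (tensor_dynP p (solution_expmx A x))).
by rewrite expmx0 mul1mx.
Qed.

(** Both sides are linear in v, so by totality it is enough to take v = x^[p];
    then both are equal to <C e^{tA} x, u>^p. *)
Lemma tensor_output_adjoint p t (v : 'cV[R]_(tdim n p)) (u : 'cV[R]_m) :
  dot (tensor_out p C *m expmx (t *: tensor_dyn p A) *m v) (tensor_power p u) =
  dot v (tensor_power p ((C *m expmx (t *: A))^T *m u)).
Proof.
rewrite dot_mulmxl; congr (dot v _); apply/eqP; rewrite -subr_eq0; apply/eqP.
apply: tensor_power_total => x.
rewrite dotBl -dot_mulmxr -tensor_output !tensor_power_dot -dot_mulmxr.
exact: subrr.
Qed.

(** Testing an output against all u^[p], which form a total family, shows that
    the unobservable subspace is the space of forms vanishing on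
    [image_union A C]. *)
Lemma observable_tensorP p :
  observable (tensor_dyn p A) (tensor_out p C) <->
  forall v : 'cV[R]_(tdim n p),
    (forall s, image_union A C s -> dot v (tensor_power p s) = 0) -> v = 0.
Proof.
have vanish (v : 'cV[R]_(tdim n p)) :
    (forall s, image_union A C s -> dot v (tensor_power p s) = 0) <->
    (\bigcap_(t in [set t : R | 0 <= t])
      [set x | tensor_out p C *m expmx (t *: tensor_dyn p A) *m x = 0]) v.
  split=> [vS t t0 /=|vK _ [t t0 [u _ <-]]].
    apply: tensor_power_total => u; rewrite tensor_output_adjoint.
    by apply: vS; exists t => //; exists u.
  by rewrite -tensor_output_adjoint (vK t t0) dot0l.
split=> [obs v /vanish|H].
  by rewrite obs.
apply/seteqP; split=> [v /vanish /H //|_ -> t _ /=].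
by rewrite mulmx0.
Qed.

Lemma image_union0 : image_union A C 0.
Proof. by exists 0 => /=; [|exists 0; rewrite ?mulmx0]. Qed.

Lemma image_unionZ c s : image_union A C s -> image_union A C (c *: s).
Proof.
by move=> [t t0 [u _ <-]]; exists t => //; exists (c *: u); rewrite ?scalemxAr.
Qed.

Lemma not_in_variety_observable :
  ~ in_proper_algebraic_variety (image_union A C) <->
  forall p, (1 <= p)%N -> observable (tensor_dyn p A) (tensor_out p C).
Proof.
rewrite (not_in_proper_varietyP image_union0 image_unionZ).
by split=> H p p1; apply/observable_tensorP/H.
Qed.

End Observability.

(** * Moments and ensemble observability *)

Section Moments.
Variables (R : realType) (k : nat).

Lemma measurable_coord (i : 'I_k) :
  measurable_fun setT (fun x : Rvec R k => (x : 'cV[R]_k) i 0).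
Proof.
apply: (measurability _ (RGenOpens.measurableE R)) => _ [_ [a [b ->] <-]].
rewrite setTI; apply: sub_sigma_algebra.
have /continuousP := @coord_continuous R k 1 i 0; apply.
exact: interval_open.
Qed.

Lemma measurable_monomial (a : k.-tuple nat) :
  measurable_fun setT (monomial a : Rvec R k -> R).
Proof.
apply: measurable_prod => i _; apply: measurable_funX; exact: measurable_coord.
Qed.

Lemma measurable_dot (u : 'cV[R]_k) :
  measurable_fun setT (dot u : Rvec R k -> R).
Proof.
rewrite (funext (dotE u)).
apply: measurable_sum => i; apply: measurable_funM => //.
exact: measurable_coord.
Qed.

Lemma measurable_euclidean_norm :
  measurable_fun setT (@euclidean_norm R k : Rvec R k -> R).
Proof.
rewrite /euclidean_norm.
apply: (measurableT_comp (f := @Num.sqrt R)).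
  apply: continuous_measurable_fun; exact: sqrt_continuous.
apply: measurable_sum => i; apply: measurable_funX; exact: measurable_coord.
Qed.

Lemma norm_monomial_le (a : k.-tuple nat) (x : 'cV[R]_k) :
  `|monomial a x| <= euclidean_norm x ^+ (\sum_i tnth a i).
Proof.
rewrite /monomial normr_prod expr_sum; apply: ler_prod => i _.
rewrite normrX exprn_ge0//= lerXn2r ?nnegrE ?sqrtr_ge0//.
rewrite -sqrtr_sqr ler_wsqrtr// (bigD1 i)//= lerDl sumr_ge0// => j _.
exact: sqr_ge0.
Qed.

Lemma integrable_monomial (P : distribution_on R k) (a : k.-tuple nat) :
  finite_moments P ->
  P.-integrable setT (fun x : Rvec R k => (monomial a x)%:E).
Proof.
move=> finP; apply: (@le_integrable _ _ _ _ _ _ _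
    (fun x : Rvec R k => (euclidean_norm x ^+ (\sum_i tnth a i))%:E)) => //.
- by apply/measurable_EFinP; exact: measurable_monomial.
- move=> x _; rewrite !abse_EFin lee_fin.
  rewrite [leRHS]ger0_norm ?exprn_ge0 ?sqrtr_ge0//.
  exact: norm_monomial_le.
- apply/integrableP; split.
    apply/measurable_EFinP; apply: measurable_funX.
    exact: measurable_euclidean_norm.
  under eq_integral do rewrite abse_EFin ger0_norm ?exprn_ge0 ?sqrtr_ge0//.
  exact: finP.
Qed.

(** The coefficients of s |-> E[<s, x>^p] on the weighted monomials. The
    multinomial coefficient is the square of the weight: one factor is kept
    here, the other one belongs to s^[p]. *)
Definition moment_form (P : distribution_on R k) p : 'cV[R]_(tdim k p) :=
  \col_i (weight R p (multi_index k p i) * fine (moment P (multi_index k p i))).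

Let dot_expE p (s x : 'cV[R]_k) : dot s x ^+ p =
  \sum_i (tensor_power p s i 0 * weight R p (multi_index k p i)) *
         monomial (multi_index k p i) x.
Proof.
rewrite -tensor_power_dot dotE; apply: eq_bigr => i _.
by rewrite tensor_powerE [tensor_power p x i 0]tensor_powerE mulrA.
Qed.

Let integrable_term P c (a : k.-tuple nat) : finite_moments P ->
  P.-integrable setT (fun x : Rvec R k => (c * monomial a x)%:E).
Proof.
move=> finP; under eq_fun do rewrite EFinM.
exact: integrableZl (integrable_monomial a finP).
Qed.

Lemma integrable_dot_exp (P : distribution_on R k) p s : finite_moments P ->
  P.-integrable setT (fun x : Rvec R k => (dot s x ^+ p)%:E).
Proof.
move=> finP; under eq_fun do rewrite dot_expE -sumEFin.
by apply: integrable_sum => // i _; exact: integrable_term.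
Qed.

Lemma integral_dot_exp (P : distribution_on R k) p s : finite_moments P ->
  (\int[P]_x (dot s x ^+ p)%:E =
   (dot (moment_form P p) (tensor_power p s))%:E)%E.
Proof.
move=> finP; under eq_integral do rewrite dot_expE -sumEFin.
rewrite integral_sum// => [|i]; last exact: integrable_term.
rewrite dotE -sumEFin; apply: eq_bigr => i _.
under eq_integral do rewrite EFinM.
have mi := integrable_monomial (multi_index k p i) finP.
rewrite integralZl// -[X in (_ * X)%E]fineK; last exact: integrable_fin_num.
by rewrite -EFinM [in RHS]mxE /moment; congr _%:E; ring.
Qed.

Lemma moment_form_inj (P Q : distribution_on R k) (a : k.-tuple nat) :
  finite_moments P -> finite_moments Q ->
  moment_form P (\sum_i tnth a i) = moment_form Q (\sum_i tnth a i) ->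
  moment P a = moment Q a.
Proof.
move=> finP finQ; have [i ia] := multi_index_surj (erefl (\sum_i tnth a i)%N).
move=> /(congr1 (fun M : 'cV_(_) => M i 0)); rewrite !mxE ia => /mulfI.
rewrite gt_eqF ?weight_gt0// => /(_ isT) PQ.
have fin_moment (P0 : distribution_on R k) :
    finite_moments P0 -> moment P0 a \is a fin_num.
  by move=> fin0; apply: integrable_fin_num => //; exact: integrable_monomial.
by rewrite -[LHS]fineK ?fin_moment// PQ fineK ?fin_moment.
Qed.

End Moments.

Lemma eq_law_integral (R : realType) d (T : measurableType d)
    (mu nu : {measure set T -> \bar R}) (f : {mfun T >-> R}) (g : R -> \bar R) :
  measurable_fun setT g ->
  mu.-integrable setT (g \o f) -> nu.-integrable setT (g \o f) ->
  (forall B, measurable B -> mu (f @^-1` B) = nu (f @^-1` B)) ->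
  (\int[mu]_x (g \o f) x = \int[nu]_x (g \o f) x)%E.
Proof.
move=> mg imu inu munu.
have mf : measurable_fun setT f by [].
rewrite -[LHS](integral_pushforward mf mg (D := setT))//.
rewrite -[RHS](integral_pushforward mf mg (D := setT))//.
by apply: eq_measure_integral => B mB _; exact: munu.
Qed.

(** The output law at time t determines the law of <u, C e^{tA} x> = <s, x> for
    every s = (C e^{tA})^T u, hence the values on [image_union A C] of the
    moment forms; these forms, and so the moments, are then equal. *)
Lemma not_in_variety_ensemble_observable (R : realType) (n m : nat)
    (A : 'M[R]_n) (C : 'M[R]_(m, n)) :
  ~ in_proper_algebraic_variety (image_union A C) ->
  ensemble_observable A C (@moment_determinate R n).
Proof.
move=> SN P Q [finP _] [finQ detQ] _ _ law; apply: detQ => // a.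
apply: moment_form_inj => //; apply/eqP; rewrite -subr_eq0; apply/eqP.
apply: (form_eq0_of_not_in_proper_variety SN) => _ [t t0 [u _ <-]].
set s := _ *m u; rewrite dotBl; apply/eqP; rewrite subr_eq0; apply/eqP.
apply: EFin_inj; rewrite -!integral_dot_exp//.
set p := (\sum_i _)%N.
pose f : {mfun Rvec R n >-> R} := mfun_Sub (mem_set (measurable_dot s)).
apply: (@eq_law_integral _ _ _ P Q f (fun y => (y ^+ p)%:E)).
- by apply/measurable_EFinP; exact: measurable_funX.
- exact: integrable_dot_exp.
- exact: integrable_dot_exp.
move=> B mB.
have fE : f @^-1` B =
    (fun x : Rvec R n => (C *m expmx (t *: A) *m x : Rvec R m)) @^-1`
      ((dot u : Rvec R m -> R) @^-1` B).
  by apply/seteqP; split=> x /=; rewrite dot_mulmxr.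
rewrite fE; apply: (law t t0).
by rewrite -[X in measurable X]setTI; exact: measurable_dot.
Qed.

Theorem theorem12 (R : realType) (n m : nat) (A : 'M[R]_n) (C : 'M[R]_(m, n)) :
  (~ in_proper_algebraic_variety (image_union A C) <->
     forall p : nat, (1 <= p)%N ->
       observable (tensor_dyn p A) (tensor_out p C)) /\
  (~ in_proper_algebraic_variety (image_union A C) ->
     ensemble_observable A C (@moment_determinate R n)).
Proof.
split; first exact: not_in_variety_observable.
exact: not_in_variety_ensemble_observable.
Qed.
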